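(* Let $G$ be a finite group, $E$ a nonzero Riesz space and $\rho\colon G\to\mathrm{Aut}^+(E)$ a positive principal band irreducible representation. Then $E$ is Archimedean, $E$ is finite dimensional, and the dimension of $E$ divides the order of $G$.
   Context: All Riesz spaces (vector lattices) are real and not assumed to be Archimedean unless stated. $\mathrm{Aut}^+(E)$ denotes the group of lattice automorphisms of a Riesz space $E$. A positive representation of a group $G$ in $E$ is a group homomorphism $\rho\colon G\to\mathrm{Aut}^+(E)$, $s\mapsto\rho_s$. A subset $D\subset E$ is $\rho$-invariant if $\rho_s D\subset D$ for all $s\in G$. A principal band is a band generated by a single element. A positive representation $\rho$ is called principal band irreducible if every $\rho$-invariant principal band equals $\{0\}$ or $E$. *)

(* Defs.v *)
From HB Require Import structures.
From mathcomp Require Import all_boot all_order all_algebra all_fingroup.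
From mathcomp Require Import boolp classical_sets reals.
Set Implicit Arguments.
Unset Strict Implicit.
Unset Printing Implicit Defensive.
Import Order.TTheory GRing.Theory Num.Theory.
Local Open Scope classical_set_scope.
Local Open Scope ring_scope.

HB.mixin Record POrderedLmodule_isRiesz (R : realType) E
    of GRing.Lmodule R E & Num.POrderedZmodule E := {
  riesz_lerD2r : forall x y z : E, x <= y -> x + z <= y + z;
  riesz_scaler_ge0 : forall (a : R) (x : E), 0 <= a -> 0 <= x -> 0 <= a *: x;
  riesz_meet : E -> E -> E;
  riesz_join : E -> E -> E;
  riesz_lexI :
    forall x y z : E, (x <= riesz_meet y z) = (x <= y) && (x <= z);
  riesz_leUx :
    forall x y z : E, (riesz_join x y <= z) = (x <= z) && (y <= z)
}.

#[short(type="rieszType")]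
HB.structure Definition Riesz (R : realType) :=
  { E of GRing.Lmodule R E & Num.POrderedZmodule E
       & POrderedLmodule_isRiesz R E }.

(* The lattice structure is an instance instead of an ancestor: Hierarchy
   Builder rejects a structure inheriting from both Lmodule and Lattice, since
   Num.RealDomain already inherits from Zmodule and Lattice without their join.
   The lattice operations are Order.join and Order.meet; Num.max and Num.min
   are meant for total orders and differ from them in general. *)
HB.instance Definition _ (R : realType) (E : rieszType R) :=
  Order.POrder_MeetJoin_isLattice.Build ring_display (Riesz.sort E)
    (@riesz_lexI R E) (@riesz_leUx R E).

Section RieszTheory.
Context {R : realType}.

Definition riesz_abs {E : rieszType R} (x : E) : E := Order.join x (- x).

Definition archimedean_riesz (E : rieszType R) : Prop :=
  forall u v : E, 0 <= v -> (forall n : nat, v *+ n <= u) -> v = 0.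

Record riesz_ideal {E : rieszType R} (D : set E) : Prop := RieszIdeal {
  riesz_ideal0 : D 0;
  riesz_idealD : forall x y : E, D x -> D y -> D (x + y);
  riesz_idealZ : forall (a : R) (x : E), D x -> D (a *: x);
  riesz_ideal_solid :
    forall x y : E, riesz_abs x <= riesz_abs y -> D y -> D x
}.

Record band {E : rieszType R} (D : set E) : Prop := Band {
  band_ideal : riesz_ideal D;
  band_sup : forall (A : set E) (z : E), A `<=` D -> supremums A z -> D z
}.

Definition principal_band {E : rieszType R} (D : set E) : Prop :=
  exists x : E, D = smallest band [set x].

Record lattice_automorphism {E : rieszType R} (T : E -> E) : Prop :=
  LatticeAutomorphism {
  lattice_aut_linear : linear T;
  lattice_aut_join :
    forall x y : E, T (Order.join x y) = Order.join (T x) (T y);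
  lattice_aut_meet :
    forall x y : E, T (Order.meet x y) = Order.meet (T x) (T y);
  lattice_aut_bij : bijective T
}.

Record positive_representation {G : finGroupType} {E : rieszType R}
    (rho : G -> E -> E) : Prop := PositiveRepresentation {
  pos_rep_aut : forall s : G, lattice_automorphism (rho s);
  pos_rep1 : rho 1%g = id;
  pos_repM : forall s t : G, rho (s * t)%g = rho s \o rho t
}.

Definition rep_invariant {G : finGroupType} {E : rieszType R}
    (rho : G -> E -> E) (D : set E) : Prop :=
  forall s : G, rho s @` D `<=` D.

Definition principal_band_irreducible {G : finGroupType} {E : rieszType R}
    (rho : G -> E -> E) : Prop :=
  forall D : set E, principal_band D -> rep_invariant rho D ->
    D = [set 0] \/ D = [set: E].

(* Vector.axiom n E is the type of linear bijections from E to 'rV[R]_n. *)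
Definition has_dim (E : rieszType R) (n : nat) : Prop :=
  inhabited (Vector.axiom n E).

End RieszTheory.

(* Main.v *)
(* Irreducibility turns every orbit sum u = sum_s rho_s x with x > 0, being
   invariant, into a generator of the band E, i.e. y = sup_n (y /\ n u) for all
   y >= 0, which is meaningful without the Archimedean property. If n v <= u for
   all n with v > 0, then the orbit sums v' and u' satisfy
   u' /\ n v' <= u' / 2 for all n, hence u' <= u' / 2, which is absurd: E is
   Archimedean. Next, E has an atom e. In an Archimedean space two atoms are
   disjoint or proportional, and rho_s e = l e forces l = 1 because s has finite
   order, so the orbit of e consists of pairwise disjoint atoms indexed by the
   cosets of the stabiliser of e. Subtracting from x >= 0 its largest multiples
   of these atoms leaves an element disjoint from the whole orbit, hence 0: the
   orbit is a basis. *)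
Require Import Defs.
From HB Require Import structures.
From mathcomp Require Import all_boot all_order all_algebra all_fingroup.
From mathcomp Require Import boolp classical_sets reals.
Set Implicit Arguments.
Unset Strict Implicit.
Unset Printing Implicit Defensive.
Import Order.TTheory GRing.Theory Num.Theory.
Local Open Scope ring_scope.

(** * Order, disjointness and truncations in a Riesz space *)

Section RieszLemmas.
Context {R : realType} {E : rieszType R}.
Implicit Types (x y z t u v w : E) (a b c : R).

Lemma riesz_lerD2 z x y : (x + z <= y + z) = (x <= y).
Proof.
apply/idP/idP; last exact: riesz_lerD2r.
by move/(riesz_lerD2r _ _ (- z)); rewrite !addrK.
Qed.

Lemma riesz_lerBlDr x y z : (x - y <= z) = (x <= z + y).
Proof. by rewrite -(riesz_lerD2 y (x - y)) subrK. Qed.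

Lemma riesz_lerBrDr x y z : (x <= y - z) = (x + z <= y).
Proof. by rewrite -(riesz_lerD2 z x (y - z)) subrK. Qed.

Lemma riesz_subr_ge0 x y : (0 <= y - x) = (x <= y).
Proof. by rewrite riesz_lerBrDr add0r. Qed.

Lemma riesz_lerD x y z t : x <= y -> z <= t -> x + z <= y + t.
Proof.
move=> xy zt; apply: (@le_trans _ _ (y + z)); first by rewrite riesz_lerD2.
by rewrite ![y + _]addrC riesz_lerD2.
Qed.

Lemma riesz_addr_ge0 x y : 0 <= x -> 0 <= y -> 0 <= x + y.
Proof. by move=> x0 y0; rewrite -(addr0 0); exact: riesz_lerD. Qed.

Lemma riesz_lerDl x y : (x <= x + y) = (0 <= y).
Proof. by rewrite -{1}(add0r x) [x + y]addrC riesz_lerD2. Qed.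

Lemma riesz_oppr_le0 x : (- x <= 0) = (0 <= x).
Proof. by rewrite -[- x]add0r riesz_lerBlDr add0r. Qed.

Lemma riesz_lerN2 x y : (- x <= - y) = (y <= x).
Proof. by rewrite -(riesz_lerD2 x (- x)) addNr addrC riesz_subr_ge0. Qed.

Lemma riesz_sumr_ge0 (I : Type) (r : seq I) (P : pred I) (F : I -> E) :
  (forall i, P i -> 0 <= F i) -> 0 <= \sum_(i <- r | P i) F i.
Proof. by move=> F0; elim/big_rec: _ => // i x Pi; apply/riesz_addr_ge0/F0. Qed.

Lemma riesz_ler_sum (I : Type) (r : seq I) (P : pred I) (F F' : I -> E) :
  (forall i, P i -> F i <= F' i) ->
  \sum_(i <- r | P i) F i <= \sum_(i <- r | P i) F' i.
Proof. by move=> FF'; elim/big_rec2: _ => // i x y Pi; apply/riesz_lerD/FF'. Qed.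

Lemma riesz_mulrn_ge0 x n : 0 <= x -> 0 <= x *+ n.
Proof. by move=> x0; elim: n => // n ih; rewrite mulrS riesz_addr_ge0. Qed.

Lemma riesz_ler_wpZ2l a x y : 0 <= a -> x <= y -> a *: x <= a *: y.
Proof.
move=> a0 xy; rewrite -riesz_subr_ge0 -scalerBr.
by apply: riesz_scaler_ge0; rewrite // riesz_subr_ge0.
Qed.

Lemma riesz_ler_wpZ2r a b x : 0 <= x -> a <= b -> a *: x <= b *: x.
Proof.
move=> x0 ab; rewrite -riesz_subr_ge0 -scalerBl.
by apply: riesz_scaler_ge0; rewrite // subr_ge0.
Qed.

Lemma riesz_ler_pZ2l a x y : 0 < a -> (a *: x <= a *: y) = (x <= y).
Proof.
move=> a0; apply/idP/idP; last exact/riesz_ler_wpZ2l/ltW.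
have ai0 : 0 <= a^-1 by rewrite invr_ge0 ltW.
by move=> /(riesz_ler_wpZ2l ai0); rewrite !scalerK// gt_eqF.
Qed.

Lemma riesz_abs_ge0 x : 0 <= riesz_abs x.
Proof.
have half0 : 0 <= 2^-1 :> R by rewrite invr_ge0.
have : 0 <= riesz_abs x + riesz_abs x.
  by rewrite -(subrr x); apply: riesz_lerD; [exact: leUl|exact: leUr].
move/(riesz_scaler_ge0 _ _ half0).
by rewrite -mulr2n -scaler_nat scalerA mulVf ?scale1r ?pnatr_eq0.
Qed.

Lemma riesz_ler_abs x : x <= riesz_abs x. Proof. exact: leUl. Qed.

Lemma riesz_lerN_abs x : - x <= riesz_abs x. Proof. exact: leUr. Qed.

Lemma riesz_abs_id x : 0 <= x -> riesz_abs x = x.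
Proof.
by move=> x0; apply: join_l; rewrite (le_trans _ x0)// riesz_oppr_le0.
Qed.

Lemma riesz_ler_absD x y : riesz_abs (x + y) <= riesz_abs x + riesz_abs y.
Proof.
rewrite leUx opprD (riesz_lerD (riesz_ler_abs x) (riesz_ler_abs y)).
exact: riesz_lerD (riesz_lerN_abs x) (riesz_lerN_abs y).
Qed.

Lemma riesz_ler_absZ a x : riesz_abs (a *: x) <= `|a| *: riesz_abs x.
Proof.
have := riesz_ler_abs x; have := riesz_lerN_abs x => xN xP.
rewrite leUx; case: (ger0P a) => [a0|/ltW a0]; rewrite -scalerN;
  apply/andP; split; try exact: riesz_ler_wpZ2l.
  by rewrite -[a *: x]opprK -scaleNr -scalerN riesz_ler_wpZ2l// oppr_ge0.
by rewrite scalerN -scaleNr riesz_ler_wpZ2l// oppr_ge0.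
Qed.

(** With [p] and [q] the two parts, [q <= p - x], so [p] minus the meet bounds both [x] and [0],
    hence also their join [p]. *)
Lemma riesz_parts_disjoint x :
  Order.meet (Order.join x 0) (Order.join (- x) 0) = 0.
Proof.
set p := Order.join x 0; set q := Order.join (- x) 0.
have qE : q <= p - x.
  by rewrite leUx riesz_lerBrDr addNr riesz_subr_ge0 leUr leUl.
apply/le_anti; rewrite lexI leUr leUr !andbT.
have : p <= p - Order.meet p q.
  rewrite leUx riesz_subr_ge0 leIl andbT riesz_lerBrDr addrC -riesz_lerBrDr.
  exact: le_trans (leIr _ _) qE.
by rewrite riesz_lerDl -riesz_lerN2 oppr0 opprK.
Qed.

Lemma riesz_parts_sub x : Order.join x 0 - Order.join (- x) 0 = x.
Proof.
apply/eqP; rewrite subr_eq; apply/eqP/le_anti/andP; split.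
  by rewrite leUx riesz_lerDl leUr addrC -riesz_lerBlDr sub0r leUl.
by rewrite addrC -riesz_lerBrDr leUx riesz_lerBrDr addNr riesz_subr_ge0 leUr leUl.
Qed.

(** The meet [w] of [x + y] and [z] has [w - y] below [x] and [z], so [w <= y]; being also below
    [z], it is 0. *)
Lemma disjointD x y z : 0 <= x -> 0 <= y -> 0 <= z ->
  Order.meet x z = 0 -> Order.meet y z = 0 -> Order.meet (x + y) z = 0.
Proof.
move=> x0 y0 z0 xz yz; apply/le_anti; rewrite lexI z0 riesz_addr_ge0// !andbT.
set w := Order.meet _ _; rewrite -yz lexI leIr andbT.
rewrite -[y]add0r -riesz_lerBlDr -xz lexI riesz_lerBlDr leIl.
by rewrite riesz_lerBlDr (le_trans (leIr _ _))// riesz_lerDl.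
Qed.

Lemma disjoint_le x y z t : 0 <= x -> 0 <= y -> x <= z -> y <= t ->
  Order.meet z t = 0 -> Order.meet x y = 0.
Proof.
move=> x0 y0 xz yt zt; apply/le_anti; rewrite lexI x0 y0 -zt !andbT.
exact: leI2.
Qed.

Lemma disjoint_sum (I : Type) (r : seq I) (P : pred I) (F : I -> E) z :
  0 <= z -> (forall i, P i -> 0 <= F i) ->
  (forall i, P i -> Order.meet (F i) z = 0) ->
  Order.meet (\sum_(i <- r | P i) F i) z = 0.
Proof.
move=> z0 F0 Fz.
suff [] : 0 <= \sum_(i <- r | P i) F i /\
    Order.meet (\sum_(i <- r | P i) F i) z = 0 by [].
elim/big_rec: _ => [|i x Pi [x0 xz]]; first by rewrite meet_l.
by split; [apply: riesz_addr_ge0 => //; exact: F0|apply: disjointD; auto].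
Qed.

Lemma disjoint_mulrn x z n : 0 <= x -> 0 <= z ->
  Order.meet x z = 0 -> Order.meet (x *+ n) z = 0.
Proof.
by move=> x0 z0 xz; rewrite -[n]card_ord -sumr_const; apply: disjoint_sum.
Qed.

Lemma riesz_ler_truncn a x : 0 <= x -> a *: x <= x *+ (Num.truncn a).+1.
Proof.
move=> x0; rewrite -scaler_nat; apply: riesz_ler_wpZ2r => //.
exact/ltW/truncnS_gt.
Qed.

Lemma disjointZ a x z : 0 <= a -> 0 <= x -> 0 <= z ->
  Order.meet x z = 0 -> Order.meet (a *: x) z = 0.
Proof.
move=> a0 x0 z0 /(disjoint_mulrn (Num.truncn a).+1 x0 z0).
by apply: disjoint_le => //; [exact: riesz_scaler_ge0|exact: riesz_ler_truncn].
Qed.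

(* For [0 <= x] this says [x = sup_n (x `&` u *+ n)], which is how the positive
   part of the principal band generated by [u] looks in any Riesz space. *)
Definition truncation_sup u x : Prop :=
  forall t, (forall n, Order.meet x (u *+ n) <= t) -> x <= t.

(** If [t] bounds the truncations of [x], then [t + (y - x)] bounds those of [y]. *)
Lemma truncation_sup_le u x y : x <= y ->
  truncation_sup u y -> truncation_sup u x.
Proof.
move=> xy yu t xt; rewrite -(riesz_lerD2 (y - x)) addrC subrK.
apply: yu => n; rewrite -riesz_lerBlDr; apply: le_trans (xt n).
rewrite lexI riesz_lerBlDr addrC subrK leIl /= riesz_lerBlDr.
by rewrite (le_trans (leIr _ _))// riesz_lerDl riesz_subr_ge0.
Qed.

(** The two suprema are taken one after the other: truncating [x] at [n u] and [y] at [m u] gives a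
    sum below the truncation of [x + y] at [(m + n) u]. *)
Lemma truncation_supD u x y : truncation_sup u x -> truncation_sup u y ->
  truncation_sup u (x + y).
Proof.
move=> xu yu t xyt; rewrite -riesz_lerBrDr; apply: xu => n.
rewrite riesz_lerBrDr addrC -riesz_lerBrDr; apply: yu => m.
rewrite riesz_lerBrDr; apply: le_trans (xyt (m + n)%N).
by rewrite lexI addrC mulrnDr addrC [x + y]addrC !riesz_lerD ?leIl ?leIr.
Qed.

Lemma truncation_supZ u a x : 0 <= x -> truncation_sup u x ->
  truncation_sup u (a *: x).
Proof.
move=> x0 xu; apply: truncation_sup_le (riesz_ler_truncn _ x0) _.
elim: _.+1 => [|n ih]; last by rewrite mulrS; exact: truncation_supD.
by move=> t /(_ 0); rewrite mulr0n meetxx.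
Qed.

Lemma truncation_sup_band u : 0 <= u ->
  band [set x : E | truncation_sup u (riesz_abs x)]%classic.
Proof.
move=> u0;
have sup0 : truncation_sup u 0 by move=> t /(_ 0); rewrite mulr0n meetxx.
split; first split => /=.
- by rewrite riesz_abs_id.
- move=> x y xu yu; apply: truncation_sup_le (riesz_ler_absD _ _) _.
  exact: truncation_supD.
- move=> a x xu; apply: truncation_sup_le (riesz_ler_absZ _ _) _.
  exact/truncation_supZ/xu/riesz_abs_ge0.
- by move=> x y; exact: truncation_sup_le.
move=> A z AD [zA zub] /=.
(* A supremum of the empty set is a least element of [E], which forces [z = 0]. *)
have [[x Ax]|A0] := pselect (exists y, A y); last first.
  have zmin t : z <= t by apply: zub => y Ay; case: A0; exists y.
  suff -> : z = 0 by rewrite riesz_abs_id.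
  by apply/le_anti; rewrite zmin -(riesz_lerDl z) zmin.
have zD : riesz_abs z <= Order.join z 0 + Order.join (- z) 0.
  rewrite leUx (le_trans (leUl z 0)) ?riesz_lerDl ?leUr//=.
  by rewrite (le_trans (leUl (- z) 0))// addrC riesz_lerDl leUr.
(* The negative part of [z] is at most [|x|] for the chosen [x] in [A]; truncations of the positive
   part dominate those of the positive part of every [y] in [A]. *)
apply: truncation_sup_le zD _; apply: truncation_supD; last first.
  apply: truncation_sup_le (AD _ Ax); rewrite leUx riesz_abs_ge0 andbT.
  by apply: le_trans (riesz_lerN_abs x); rewrite riesz_lerN2; exact: zA.
move=> t zt; have t0 : 0 <= t.
  by apply: le_trans (zt 0); rewrite mulr0n lexI leUr lexx.
rewrite leUx t0 andbT; apply: zub => y Ay.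
apply: le_trans (leUl y 0) _.
have : truncation_sup u (Order.join y 0).
  by apply: truncation_sup_le (AD _ Ay); rewrite leUx riesz_ler_abs riesz_abs_ge0.
apply => n; apply: le_trans (zt n).
by apply: leI2 => //; apply: leU2 => //; exact: zA.
Qed.

Lemma archimedean_le0 x u : archimedean_riesz E -> 0 <= u ->
  (forall n, x <= n.+1%:R^-1 *: u) -> x <= 0.
Proof.
move=> arch u0 xu; suff <- : Order.join x 0 = 0 by exact: leUl.
apply: (arch u); first exact: leUr.
case=> [|n]; rewrite ?mulr0n//.
rewrite -scaler_nat -(@riesz_ler_pZ2l n.+1%:R^-1) ?invr_gt0// scalerK ?pnatr_eq0//.
by rewrite leUx xu riesz_scaler_ge0 ?invr_ge0.
Qed.

End RieszLemmas.

(** * Atoms, and bases of pairwise disjoint elements *)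

Section Atoms.
Context {R : realType} {E : rieszType R}.
Implicit Types (x y z e : E) (t : R).

(** The condition makes sense in any Riesz space; in an Archimedean one it says that the interval
    from 0 to [e] consists of multiples of [e]. *)
Definition riesz_atom e : Prop := [/\ 0 <= e, e != 0 &
  forall y z, 0 <= y -> y <= e -> 0 <= z -> z <= e ->
    Order.meet y z = 0 -> y = 0 \/ z = 0].

(** The positive and negative parts of [x - t *: e] are disjoint and below [e], so one of them
    vanishes. *)
Lemma riesz_atom_cmp e x t : riesz_atom e -> 0 <= x -> x <= e ->
  0 <= t -> t <= 1 -> t *: e <= x \/ x <= t *: e.
Proof.
move=> [e0 _ eat] x0 xe t0 t1.
have te0 : 0 <= t *: e by exact: riesz_scaler_ge0.
have te : t *: e <= e by rewrite -[leRHS]scale1r; exact: riesz_ler_wpZ2r.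
have := riesz_parts_disjoint (x - t *: e); rewrite opprB => /eat[].
- exact: leUr.
- by rewrite leUx e0 andbT riesz_lerBlDr (le_trans xe)// riesz_lerDl.
- exact: leUr.
- by rewrite leUx e0 andbT riesz_lerBlDr (le_trans te)// riesz_lerDl.
- by move=> p0; right; rewrite -[x](subrK (t *: e)) -riesz_lerBrDr subrr -p0 leUl.
- by move=> q0; left; rewrite -[t *: e](subrK x) -riesz_lerBrDr subrr -q0 leUl.
Qed.

(* [l] is the largest [t] with [t *: e <= x]. *)
Lemma riesz_atom_decomp e x : archimedean_riesz E -> riesz_atom e -> 0 <= x ->
  exists2 l : R, 0 <= l & l *: e <= x /\ Order.meet (x - l *: e) e = 0.
Proof.
move=> arch eat x0; have [e0 en0 _] := eat.
pose S : set R := [set t | t *: e <= x]%classic.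
have S0 : S 0 by rewrite /S /= scale0r.
have supS : has_sup S.
  split; first by exists 0.
  apply: contrapT => Sub; move/eqP: en0; apply; apply: (arch x) => // n.
  apply: contrapT => nx; apply: Sub; exists n%:R => t St.
  rewrite leNgt; apply/negP => /ltW nt; apply: nx; apply: le_trans St.
  by rewrite -scaler_nat; exact: riesz_ler_wpZ2r.
have inv0 n : 0 < n.+1%:R^-1 :> R by rewrite invr_gt0.
(* The supremum is attained, since [sup S *: e - x] is below every [e / (n+1)]. *)
have lx : sup S *: e <= x.
  rewrite -[leLHS](subrK x) -riesz_lerBrDr subrr.
  apply: (archimedean_le0 arch e0) => n.
  have [t St lt] := sup_adherent (inv0 n) supS.
  rewrite riesz_lerBlDr; apply: (@le_trans _ _ (n.+1%:R^-1 *: e + t *: e)).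
    rewrite -scalerDl; apply: riesz_ler_wpZ2r => //.
    by rewrite addrC -lerBlDr ltW.
  exact: riesz_lerD.
have y0 : 0 <= x - sup S *: e by rewrite riesz_subr_ge0.
exists (sup S); first exact: (sup_upper_bound supS S0).
split=> //; apply/le_anti; rewrite lexI y0 e0 !andbT.
(* The meet is comparable with [e / (n+1)]; were it above, [sup S + 1/(n+1)] would lie in [S]. *)
apply: (archimedean_le0 arch e0) => n.
have [| | | |tl|//] := @riesz_atom_cmp e (Order.meet (x - sup S *: e) e) n.+1%:R^-1 eat.
- by rewrite lexI y0.
- exact: leIr.
- exact: ltW.
- by rewrite invf_le1 ?ler1n.
have : S (sup S + n.+1%:R^-1).
  rewrite /S /= scalerDl addrC -riesz_lerBrDr; exact: le_trans tl (leIl _ _).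
by move/(sup_upper_bound supS); rewrite gerDl leNgt inv0.
Qed.

(** Induction on [r]: the remainder loses its largest multiple of the next atom and, getting
    smaller, stays disjoint from the earlier ones. *)
Lemma riesz_atoms_decomp n (f : 'I_n -> E) (r : seq 'I_n) x :
  archimedean_riesz E -> (forall i, riesz_atom (f i)) -> 0 <= x ->
  exists (c : 'I_n -> R), exists2 y, 0 <= y & x = \sum_i c i *: f i + y /\
    forall i, i \in r -> Order.meet y (f i) = 0.
Proof.
move=> arch fat x0; elim: r => [|j r [c [y y0 [xE yr]]]].
  exists (fun=> 0), x => //; split=> //.
  by rewrite big1 ?add0r// => i _; rewrite scale0r.
have [l l0 [ly yj]] := riesz_atom_decomp arch (fat j) y0.
have [fj0 _ _] := fat j.
have y'0 : 0 <= y - l *: f j by rewrite riesz_subr_ge0.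
exists (fun i => c i + l *+ (i == j)), (y - l *: f j) => //; split.
  under eq_bigr do rewrite scalerDl.
  rewrite big_split /= (bigD1 j (F := fun i => (l *+ _) *: _))//= eqxx.
  rewrite [X in _ + (_ + X)]big1 ?addr0 => [|i /negbTE->]; last first.
    by rewrite scale0r.
  by rewrite xE mulr1n -addrA [l *: _ + _]addrC subrK.
move=> i; rewrite inE => /predU1P[->//|ir].
have [fi0 _ _] := fat i.
apply: disjoint_le (yr _ ir) => //.
by rewrite riesz_lerBlDr riesz_lerDl riesz_scaler_ge0.
Qed.

(** The disjoint elements [l *: e] and [f - l *: e] add up to the atom [f], so one of them
    vanishes. *)
Lemma riesz_atom_proportional e f : archimedean_riesz E ->
  riesz_atom e -> riesz_atom f ->
  Order.meet f e = 0 \/ exists l, f = l *: e.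
Proof.
move=> arch eat fat; have [e0 en0 _] := eat; have [f0 _ fdisj] := fat.
have [l l0 [lf fe]] := riesz_atom_decomp arch eat f0.
have y0 : 0 <= f - l *: e by rewrite riesz_subr_ge0.
have le0 : 0 <= l *: e by exact: riesz_scaler_ge0.
have : Order.meet (l *: e) (f - l *: e) = 0 by apply: disjointZ => //; rewrite meetC.
case/fdisj => //.
- by rewrite riesz_lerBlDr riesz_lerDl.
- by move=> lz; left; rewrite -fe lz subr0.
- by move/eqP; rewrite subr_eq0 => /eqP; right; exists l.
Qed.

(** Isolating the index [j] puts [|c j| f j] below a combination [y] of the other terms, from which
    it is disjoint; so it is 0. *)
Lemma riesz_disjoint_free n (f : 'I_n -> E) (c : 'I_n -> R) :
  (forall i, 0 <= f i) -> (forall i, f i != 0) ->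
  (forall i j, i != j -> Order.meet (f i) (f j) = 0) ->
  \sum_i c i *: f i = 0 -> forall i, c i = 0.
Proof.
move=> f0 fn0 fd s0 j; apply/eqP; rewrite -normr_eq0; apply/eqP.
set y := \sum_(i < n | i != j) `|c i| *: f i.
have cf0 i : 0 <= `|c i| *: f i by exact: riesz_scaler_ge0.
have cjy : `|c j| *: f j <= y.
  have -> : `|c j| *: f j = \sum_(i < n | i != j) (- Num.sg (c j) * c i) *: f i.
    move: s0; rewrite (bigD1 j)//= => /eqP; rewrite addr_eq0 => /eqP s0.
    rewrite normrEsg -scalerA s0 scalerN -scaleNr scaler_sumr.
    by apply: eq_bigr => i _; rewrite scalerA.
  apply: riesz_ler_sum => i _; apply: riesz_ler_wpZ2r => //.
  rewrite (le_trans (ler_norm _))// normrM normrN normr_sg.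
  by case: eqP => _; rewrite ?mul0r ?mul1r.
have y0 : 0 <= y by exact: riesz_sumr_ge0.
have : Order.meet y (`|c j| *: f j) = 0.
  apply: disjoint_sum => // i ij.
  apply: disjointZ => //; rewrite meetC; apply: disjointZ => //.
  by rewrite meetC fd.
rewrite meet_r// => /eqP; rewrite scaler_eq0 (negbTE (fn0 j)) orbF.
by move/eqP.
Qed.

(** [vec] is the inverse of the coordinate map that [Vector.axiom] asks for; its injectivity makes
    the chosen [coord] linear. *)
Lemma has_dim_basis n (f : 'I_n -> E) :
  (forall c : 'I_n -> R, \sum_i c i *: f i = 0 -> forall i, c i = 0) ->
  (forall x, exists c : 'I_n -> R, x = \sum_i c i *: f i) -> has_dim E n.
Proof.
move=> free span.
pose vec (v : 'rV[R]_n) := \sum_i v 0 i *: f i.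
have vec_lin a v w : vec (a *: v + w) = a *: vec v + vec w.
  rewrite /vec scaler_sumr -big_split; apply: eq_bigr => i _ /=.
  by rewrite !mxE scalerDl scalerA.
have vec_inj : injective vec.
  move=> v w vw; apply/rowP => i; apply/eqP; rewrite -subr_eq0; apply/eqP.
  move: i; apply: free; under eq_bigr do rewrite scalerBl.
  by rewrite sumrB; apply/eqP; rewrite subr_eq0; apply/eqP; exact: vw.
have /choice[coord coordK] : forall x, exists v, vec v = x.
  move=> x; have [c ->] := span x; exists (\row_i c i).
  by apply: eq_bigr => i _; rewrite mxE.
constructor; exists coord.
- by move=> a x y; apply: vec_inj; rewrite vec_lin !coordK.
- by exists vec => [x|v]; [exact: coordK|apply: vec_inj; rewrite coordK].
Qed.

End Atoms.

(** The right-hand side is a band containing [u]. Conversely, [|x|] is the supremum of its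
    truncations, which lie in every ideal containing [u]. *)
Lemma principal_bandE (R : realType) (E : rieszType R) (u : E) : 0 <= u ->
  smallest band [set u]%classic =
  [set x | truncation_sup u (riesz_abs x)]%classic.
Proof.
move=> u0; apply/seteqP; split=> x /=.
  move=> /(_ [set x : E | truncation_sup u (riesz_abs x)]%classic).
  apply; split; first exact: truncation_sup_band.
  move=> _ -> t /(_ 1); rewrite /= riesz_abs_id// mulr1n meetxx.
  by [].
move=> xu M [[[_ _ MZ Msolid] Msup] uM].
have absx : M (riesz_abs x).
  apply: (Msup (range (fun n => Order.meet (riesz_abs x) (u *+ n)))%classic).
    move=> _ [n _ <-]; apply: (Msolid _ (n%:R *: u)); last exact/MZ/uM.
    have un0 : 0 <= u *+ n by exact: riesz_mulrn_ge0.
    have mn0 : 0 <= Order.meet (riesz_abs x) (u *+ n).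
      by rewrite lexI riesz_abs_ge0.
    by rewrite scaler_nat (riesz_abs_id mn0) (riesz_abs_id un0) leIr.
  split; first by move=> _ [n _ <-]; exact: leIl.
  by move=> t ubt; apply: xu => n; apply: ubt; exists n.
by apply: Msolid absx; rewrite (riesz_abs_id (riesz_abs_ge0 x)).
Qed.

(** * Positive representations of a finite group and orbit sums *)

Section PositiveRepresentation.
Context {R : realType} {G : finGroupType} {E : rieszType R}.
Variable rho : G -> E -> E.
Hypothesis rho_rep : positive_representation rho.
Implicit Types (s t : G) (x y z e u v : E).

Lemma rep_linear s (a : R) x y : rho s (a *: x + y) = a *: rho s x + rho s y.
Proof. exact: lattice_aut_linear (pos_rep_aut rho_rep s) a x y. Qed.

Lemma rep_add s x y : rho s (x + y) = rho s x + rho s y.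
Proof. by rewrite -[x]scale1r rep_linear !scale1r. Qed.

Lemma rep0 s : rho s 0 = 0.
Proof. by apply/(addrI (rho s 0)); rewrite -rep_add !addr0. Qed.

Lemma rep_scale s (a : R) x : rho s (a *: x) = a *: rho s x.
Proof. by rewrite -[a *: x]addr0 rep_linear rep0 addr0. Qed.

Lemma rep_mulrn s x n : rho s (x *+ n) = rho s x *+ n.
Proof. by rewrite -!scaler_nat rep_scale. Qed.

Lemma rep_meet s x y : rho s (Order.meet x y) = Order.meet (rho s x) (rho s y).
Proof. exact: lattice_aut_meet (pos_rep_aut rho_rep s) x y. Qed.

Lemma rep_abs s x : rho s (riesz_abs x) = riesz_abs (rho s x).
Proof.
rewrite /riesz_abs (lattice_aut_join (pos_rep_aut rho_rep s)).
by rewrite -[in LHS]scaleN1r rep_scale scaleN1r.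
Qed.

Lemma rep_mul s t x : rho (s * t)%g x = rho s (rho t x).
Proof. by rewrite (pos_repM rho_rep). Qed.

Lemma rep1 x : rho 1%g x = x.
Proof. by rewrite (pos_rep1 rho_rep). Qed.

Lemma repK s : cancel (rho s) (rho s^-1%g).
Proof. by move=> x; rewrite -rep_mul mulVg rep1. Qed.

Lemma repKV s : cancel (rho s^-1%g) (rho s).
Proof. by move=> x; rewrite -rep_mul mulgV rep1. Qed.

Lemma rep_eq0 s x : (rho s x == 0) = (x == 0).
Proof. by rewrite -{1}(rep0 s) (can_eq (repK s)). Qed.

Lemma rep_le s x y : (rho s x <= rho s y) = (x <= y).
Proof. by rewrite !leEmeet -rep_meet (can_eq (repK s)). Qed.

Lemma rep_ge0 s x : (0 <= rho s x) = (0 <= x).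
Proof. by rewrite -{1}(rep0 s) rep_le. Qed.

Lemma rep_sum s (I : finType) (F : I -> E) :
  rho s (\sum_i F i) = \sum_i rho s (F i).
Proof. by elim/big_rec2: _ => [|i x y _ <-]; rewrite ?rep0 ?rep_add. Qed.

Definition orbit_sum x : E := \sum_s rho s x.

Lemma rep_orbit_sum t x : rho t (orbit_sum x) = orbit_sum x.
Proof.
rewrite rep_sum [RHS](reindex_inj (mulgI t)).
by apply: eq_bigr => s _; rewrite rep_mul.
Qed.

Lemma orbit_sum_ge0 x : 0 <= x -> 0 <= orbit_sum x.
Proof. by move=> x0; apply: riesz_sumr_ge0 => s _; rewrite rep_ge0. Qed.

Lemma orbit_sum_ge x : 0 <= x -> x <= orbit_sum x.
Proof.
move=> x0; rewrite /orbit_sum (bigD1 1%g)//= rep1 riesz_lerDl.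
by apply: riesz_sumr_ge0 => s _; rewrite rep_ge0.
Qed.

Lemma rep_atom s e : riesz_atom e -> riesz_atom (rho s e).
Proof.
have le_inv x : x <= rho s e -> rho s^-1%g x <= e.
  by rewrite -{1}[x](repKV s) rep_le.
move=> [e0 en0 eat]; split; rewrite ?rep_ge0 ?rep_eq0// => y z y0 ye z0 ze yz.
have : rho s^-1%g (Order.meet y z) = 0 by rewrite yz rep0.
rewrite rep_meet => /eat; rewrite !rep_ge0 => /(_ y0 (le_inv _ ye) z0 (le_inv _ ze)).
by case=> /eqP; rewrite rep_eq0 => /eqP ->; [left|right].
Qed.

(* If [rho s e = l *: e] then [l ^+ #[s] = 1]. *)
Lemma rep_atom_fix s e : archimedean_riesz E -> riesz_atom e ->
  Order.meet (rho s e) e = 0 \/ rho s e = e.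
Proof.
move=> arch eat; have [e0 en0 _] := eat.
have [|[l le]] := riesz_atom_proportional arch eat (rep_atom s eat).
  by left.
right; have lX n : rho (s ^+ n)%g e = l ^+ n *: e.
  elim: n => [|n ih]; first by rewrite expg0 rep1 scale1r.
  by rewrite expgS rep_mul ih rep_scale le scalerA exprSr.
(* Positivity of [rho s] rules out [l = -1], the other real root of unity. *)
have l0 : 0 <= l.
  rewrite leNgt; apply/negP => l0; move: en0; rewrite eq_le e0 andbT.
  rewrite -(@riesz_ler_pZ2l _ _ (- l)) ?oppr_gt0// scaler0 scaleNr -le.
  by rewrite riesz_oppr_le0 rep_ge0 e0.
have : l ^+ #[s]%g = 1.
  apply/eqP; rewrite -subr_eq0; have /eqP := lX #[s]%g.
  rewrite expg_order rep1 -{1}[e]scale1r eq_sym -subr_eq0 -scalerBl scaler_eq0.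
  by rewrite (negbTE en0) orbF.
move/eqP; rewrite pexpr_eq1// => /eqP l1.
by rewrite le l1 scale1r.
Qed.

(** * Consequences of irreducibility *)

Hypothesis rho_irr : principal_band_irreducible rho.

(** The orbit sum is fixed by [rho] and lies above [x], so the principal band it generates is
    invariant and nonzero, hence all of [E]. *)
Lemma irreducible_truncation_sup x y : 0 <= x -> x != 0 ->
  truncation_sup (orbit_sum x) (riesz_abs y).
Proof.
move=> x0 xn0; have u0 := orbit_sum_ge0 x0.
have uP : smallest band [set orbit_sum x]%classic (orbit_sum x).
  by move=> M [_]; apply.
have [|||DT] := rho_irr (D := smallest band [set orbit_sum x]%classic).
- by exists (orbit_sum x).
- rewrite principal_bandE// => s _ [z /= zu <-].
  move=> t zt; rewrite -rep_abs -[t](repKV s) rep_le; apply: zu => n.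
  rewrite -(rep_le s) repKV rep_meet rep_mulrn rep_orbit_sum rep_abs.
  exact: zt.
- move=> D0; move: uP; rewrite D0 /= => uz; move/eqP: xn0; case.
  by apply/le_anti; rewrite x0 -uz orbit_sum_ge.
have : [set: E]%classic y by [].
by rewrite -DT principal_bandE.
Qed.

Lemma irreducible_archimedean : archimedean_riesz E.
Proof.
move=> u v v0 vu; apply/eqP; apply: contrapT => /negP vn0.
have u0 : 0 <= u by have := vu 0; rewrite mulr0n.
have wu n : orbit_sum v *+ n <= orbit_sum u.
  rewrite -sumrMnl; apply: riesz_ler_sum => s _.
  by rewrite -rep_mulrn rep_le.
have half0 : 0 < 2^-1 :> R by rewrite invr_gt0.
have uu0 := orbit_sum_ge0 u0.
(* The truncation at [n] is at most [orbit_sum v *+ n], and twice this is still below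
   [orbit_sum u]. *)
have uhalf : orbit_sum u <= 2^-1 *: orbit_sum u.
  have := irreducible_truncation_sup (y := orbit_sum u) v0 vn0.
  rewrite riesz_abs_id//; apply => n.
  rewrite (le_trans (leIr _ _))//.
  rewrite -(@riesz_ler_pZ2l _ _ 2)// scalerA mulfV ?pnatr_eq0// scale1r.
  by rewrite scaler_nat -mulrnA.
suff u'0 : orbit_sum u <= 0.
  move/eqP: vn0; apply; apply/le_anti; rewrite v0 andbT -[v]mulr1n.
  exact: le_trans (vu 1) (le_trans (orbit_sum_ge u0) u'0).
rewrite -(@riesz_ler_pZ2l _ _ 2^-1)// scaler0.
rewrite -(riesz_lerD2 (2^-1 *: orbit_sum u)) add0r -scalerDl.
by have -> : 2^-1 + 2^-1 = 1 :> R; rewrite ?scale1r// [RHS]splitr mul1r.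
Qed.

(** [y] is disjoint from the orbit sum of [x], so its truncations all vanish and 0 bounds them. *)
Lemma irreducible_disjoint_orbit x y : 0 <= x -> x != 0 -> 0 <= y ->
  (forall s, Order.meet (rho s x) y = 0) -> y = 0.
Proof.
move=> x0 xn0 y0 xy; apply/le_anti; rewrite y0 andbT.
have := irreducible_truncation_sup (y := y) x0 xn0.
rewrite riesz_abs_id//; apply => n.
rewrite meetC disjoint_mulrn ?orbit_sum_ge0//.
by apply: disjoint_sum => // s _; rewrite rep_ge0.
Qed.

(* A nonzero [x >= 0] with as few [s] as possible such that [x] meets [rho s x]
   is an atom: if [y, z <= x] are disjoint and nonzero, then some [rho s y]
   meets [z], and the part [v] of [y] moved below [z] by [rho s] has a smaller
   such set, as it misses [s]. *)
Lemma irreducible_atom : (exists x : E, x != 0) -> exists e, riesz_atom e.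
Proof.
move=> [x1 x1n0].
pose F x := [set s | Order.meet x (rho s x) != 0]%SET.
pose P n := `[< exists x, [/\ 0 <= x, x != 0 & #|F x| = n] >].
have exP : exists n, P n.
  exists #|F (riesz_abs x1)|; apply/asboolP; exists (riesz_abs x1).
  split; rewrite ?riesz_abs_ge0//; apply: contra_neq x1n0 => x10.
  apply/le_anti/andP; split; first by rewrite -x10 riesz_ler_abs.
  by rewrite -riesz_oppr_le0 -x10 riesz_lerN_abs.
have [n /asboolP[x [x0 xn0 xn]] nmin] := ex_minnP exP.
(* [F y] is contained in [F x], and minimality of [#|F x|] makes them equal. *)
have Fle y : 0 <= y -> y != 0 -> y <= x -> F y = F x.
  move=> y0 yn0 yx; apply/eqP; rewrite eqEcard xn nmin ?andbT; last first.
    by apply/asboolP; exists y.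
  apply/fintype.subsetP => s; rewrite !inE; apply: contra_neq.
  by apply: disjoint_le; rewrite ?rep_ge0 ?rep_le.
exists x; split=> // y z y0 yx z0 zx yz.
have [->|yn0] := eqVneq y 0; first by left.
have [->|zn0] := eqVneq z 0; first by right.
have [s ys] : exists s, Order.meet (rho s y) z != 0.
  apply: contrapT => nys; move/eqP: zn0; apply.
  apply: (irreducible_disjoint_orbit y0 yn0 z0) => s.
  by apply/eqP; apply: contrapT => /negP ys; apply: nys; exists s.
pose v := rho s^-1%g (Order.meet (rho s y) z).
have v0 : 0 <= v by rewrite rep_ge0 lexI rep_ge0 y0.
have vn0 : v != 0 by rewrite rep_eq0.
have vy : v <= y by rewrite -(rep_le s) repKV leIl.
have sx : s \in F x.
  rewrite inE; apply: contra_neq ys; rewrite meetC.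
  by apply: disjoint_le; rewrite ?rep_ge0 ?rep_le.
move: sx; rewrite -(Fle v)// ?(le_trans vy)// inE; case/eqP.
by apply: disjoint_le yz => //; [rewrite rep_ge0|rewrite /v repKV leIr].
Qed.

End PositiveRepresentation.

(** * The orbit of an atom as a basis *)

Theorem theorem3p14 (R : realType) (G : finGroupType) (E : rieszType R)
    (rho : G -> E -> E)
    (E_nonzero : exists x : E, x != 0)
    (rho_rep : positive_representation rho)
    (rho_irr : principal_band_irreducible rho) :
  archimedean_riesz E /\
  exists n : nat, has_dim E n /\ (n %| #|G|)%N.
Proof.
have arch := irreducible_archimedean rho_rep rho_irr.
split=> //.
have [e eat] := irreducible_atom rho_rep rho_irr E_nonzero.
have [e0 en0 _] := eat.
(* The stabiliser of [e]; the basis is indexed by its left cosets. *)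
have HG : group_set [set s | rho s e == e]%SET.
  apply/group_setP; split=> [|s t]; rewrite !inE; first by rewrite rep1.
  by move=> /eqP se /eqP te; rewrite rep_mul// te se.
pose H := Group HG; pose n := #|lcosets H [set: G]|.
exists n; split; last first.
  by rewrite -cardsT /n card_lcosets dvdn_indexg.
pose f (i : 'I_n) := rho (repr (enum_val i)) e.
have fE s : rho s e = rho (repr (s *: H)%g) e.
  have /lcosetP[h] := mem_repr s (lcoset_refl H s).
  by rewrite inE => /eqP he ->; rewrite rep_mul// he.
have f0 i : 0 <= f i by rewrite rep_ge0.
have fd i j : i != j -> Order.meet (f i) (f j) = 0.
  move=> ij; set s := repr (enum_val i); set t := repr (enum_val j).
  (* Applying [rho t^-1] leaves the meet of [rho (t^-1 * s) e] and [e]: it is 0, or [t^-1 * s] is in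
     [H] and the cosets agree. *)
  apply/eqP; rewrite -(rep_eq0 rho_rep t^-1%g) rep_meet// repK// -rep_mul//.
  have [->//|ste] := rep_atom_fix rho_rep (t^-1 * s)%g arch eat.
  case/eqP: ij; apply/enum_val_inj.
  have coset (k : 'I_n) : enum_val k = (repr (enum_val k) *: H)%g.
    have /lcosetsP[x _ kx] := enum_valP k.
    by rewrite kx; apply/esym/(lcoset_eqP (G := H))/(mem_repr x)/lcoset_refl.
  rewrite coset [RHS]coset; apply/(lcoset_eqP (G := H)).
  by rewrite mem_lcoset inE; apply/eqP.
apply: (has_dim_basis (f := f)).
  by move=> c; apply: riesz_disjoint_free => // i; rewrite rep_eq0.
have pos_span (x : E) : 0 <= x -> exists c : 'I_n -> R, x = \sum_i c i *: f i.
  have fat i : riesz_atom (f i) by exact: rep_atom.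
  move=> x0.
  have [c [y y0 [xE yd]]] :=
    riesz_atoms_decomp (enum 'I_n) arch fat x0.
  (* Every [rho s e] is some [f i], so the remainder [y] is disjoint from the whole orbit. *)
  have y_disj := irreducible_disjoint_orbit rho_rep rho_irr e0 en0 y0.
  exists c; rewrite xE y_disj ?addr0// => s; rewrite fE meetC.
  have sH : (s *: H)%g \in lcosets H [set: G] by apply/lcosetsP; exists s.
  have := yd (enum_rank_in sH (s *: H)%g).
  by rewrite /f enum_rankK_in// mem_enum; apply.
move=> x.
have [c cE] := pos_span (Order.join x 0) (leUr _ _).
have [d dE] := pos_span (Order.join (- x) 0) (leUr _ _).
exists (fun i => c i - d i); rewrite -[LHS]riesz_parts_sub cE dE -sumrB.
by apply: eq_bigr => i _; rewrite scalerBl.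
Qed.
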